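(* Assume Matiyasevich's conjecture: for every positive integer $q$, each recursively enumerable set $\mathcal{M} \subseteq \mathbb{N}^q$ has a single-fold Diophantine representation. Then for every computable function $f:\mathbb{N} \to \mathbb{N}$ there is a positive integer $m(f)$ such that for each integer $n \geq m(f)$ there exists a system $U \subseteq E_n$ which has exactly $f(n)$ solutions in non-negative integers $x_1,\ldots,x_n$.
   Context: $\mathbb{N}=\{0,1,2,\ldots\}$ is the set of non-negative integers. For a positive integer $n$, $E_n$ denotes the finite set of formal equations in the variables $x_1,\ldots,x_n$ given by $E_n=\{x_i=1,\ x_i+x_j=x_k,\ x_i\cdot x_j=x_k : i,j,k\in\{1,\ldots,n\}\}$ (the indices $i,j,k$ need not be distinct). A system $U\subseteq E_n$ is a set of such equations, and a solution of $U$ is an $n$-tuple $(x_1,\ldots,x_n)$ satisfying all equations of $U$ simultaneously (all $n$ variables are counted, even if some do not occur in $U$). A Diophantine representation of a set $\mathcal{M}\subseteq\mathbb{N}^q$ is a polynomial $W(a_1,\ldots,a_q,x_1,\ldots,x_m)$ with integer coefficients such that for all $(a_1,\ldots,a_q)\in\mathbb{N}^q$, $$(a_1,\ldots,a_q)\in\mathcal{M}\iff \exists x_1,\ldots,x_m\in\mathbb{N}\ \ W(a_1,\ldots,a_q,x_1,\ldots,x_m)=0.$$ The representation is single-fold if for any $a_1,\ldots,a_q\in\mathbb{N}$ the equation $W(a_1,\ldots,a_q,x_1,\ldots,x_m)=0$ has at most one solution $(x_1,\ldots,x_m)\in\mathbb{N}^m$. *)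

(* Defs.v *)
From HB Require Import structures.
From mathcomp Require Import all_boot all_order all_algebra.
From mathcomp Require Import mpoly.

Set Implicit Arguments.
Unset Strict Implicit.
Unset Printing Implicit Defensive.

(* Syntax of the partial mu-recursive functions of [n] arguments. *)
Inductive recfun : nat -> Type :=
| rzero n : recfun n
| rsucc : recfun 1
| rproj n (i : 'I_n) : recfun n
| rcomp k n (c : recfun k) (d : 'I_k -> recfun n) : recfun n
| rprec k (c : recfun k) (d : recfun k.+2) : recfun k.+1
| rmin k (c : recfun k.+1) : recfun k.

(* [reval c v y]: the partial function coded by [c] is defined at [v], with
   value [y].  Primitive recursion is on the first argument, and [h] lists its
   successive values.  In [rmin c], the sought value is the first argument of
   [c], and all values of [c] before the first zero have to be defined. *)
Fixpoint reval n (c : recfun n) : n.-tuple nat -> nat -> Prop :=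
  match c in recfun n return n.-tuple nat -> nat -> Prop with
  | rzero _ => fun _ y => y = 0
  | rsucc => fun v y => y = (thead v).+1
  | rproj _ i => fun v y => y = tnth v i
  | rcomp k _ c d => fun v y =>
      exists w : k.-tuple nat,
        (forall i : 'I_k, reval (d i) v (tnth w i)) /\ reval c w y
  | rprec k c d => fun v y =>
      exists h : nat -> nat,
        [/\ reval c [tuple of behead v] (h 0),
            forall i, i < thead v ->
              reval d [tuple of i :: h i :: behead v] (h i.+1)
          & y = h (thead v)]
  | rmin k c => fun v y =>
      reval c [tuple of y :: v] 0 /\
      forall z, z < y -> exists u, reval c [tuple of z :: v] u.+1
  end.

Definition computable (f : nat -> nat) : Prop :=
  exists c : recfun 1, forall n, reval c [tuple n] (f n).

(* Recursively enumerable: the domain of a partial recursive function. *)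
Definition recursively_enumerable q (M : q.-tuple nat -> Prop) : Prop :=
  exists c : recfun q, forall a, M a <-> exists y, reval c a y.

Definition poly_zero q m (W : {mpoly int[q + m]})
    (a : q.-tuple nat) (x : m.-tuple nat) : Prop :=
  W.@[fun i => Posz (tnth [tuple of a ++ x] i)] = 0%R.

Definition diophantine_representation q m (M : q.-tuple nat -> Prop)
    (W : {mpoly int[q + m]}) : Prop :=
  forall a, M a <-> exists x : m.-tuple nat, poly_zero W a x.

Definition single_fold q m (W : {mpoly int[q + m]}) : Prop :=
  forall (a : q.-tuple nat) (x y : m.-tuple nat),
    poly_zero W a x -> poly_zero W a y -> x = y.

Definition Matiyasevich_conjecture : Prop :=
  forall q, 0 < q ->
  forall M : q.-tuple nat -> Prop, recursively_enumerable M ->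
  exists (m : nat) (W : {mpoly int[q + m]}),
    diophantine_representation M W /\ single_fold W.

(* The formal equations x_i = 1, x_i + x_j = x_k and x_i * x_j = x_k; the type
   [equation n] is E_n, with variables indexed from 0. *)
Inductive equation n : Type :=
| EqOne (i : 'I_n)
| EqAdd (i j k : 'I_n)
| EqMul (i j k : 'I_n).

Section EquationFinite.
Variable n : nat.

Definition equation_code (e : equation n) :
    'I_n + ('I_n * 'I_n * 'I_n + 'I_n * 'I_n * 'I_n) :=
  match e with
  | EqOne i => inl i
  | EqAdd i j k => inr (inl (i, j, k))
  | EqMul i j k => inr (inr (i, j, k))
  end.

Definition equation_decode
    (s : 'I_n + ('I_n * 'I_n * 'I_n + 'I_n * 'I_n * 'I_n)) : equation n :=
  match s with
  | inl i => EqOne i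
  | inr (inl (i, j, k)) => EqAdd i j k
  | inr (inr (i, j, k)) => EqMul i j k
  end.

Lemma equation_codeK : cancel equation_code equation_decode.
Proof. by case. Qed.

HB.instance Definition _ :=
  Finite.copy (equation n) (can_type equation_codeK).

End EquationFinite.

Definition satisfies n (x : n.-tuple nat) (e : equation n) : bool :=
  match e with
  | EqOne i => tnth x i == 1
  | EqAdd i j k => tnth x i + tnth x j == tnth x k
  | EqMul i j k => tnth x i * tnth x j == tnth x k
  end.

Definition solution n (U : {set equation n}) (x : n.-tuple nat) : bool :=
  [forall e in U, satisfies x e].

Definition has_exactly (T : eqType) (k : nat) (P : pred T) : Prop :=
  exists s : seq T, [/\ uniq s, size s = k & forall x, (x \in s) = P x].

(* Main.v *)
(* The set of all (n, t) with t < f n is recursively enumerable, and for fixed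
   n a single-fold representation W(n, t, x) = 0 of it has exactly f n solutions
   (t, x).  Evaluating W step by step turns it into equations of E_k without
   changing the number of solutions, with k independent of n; pinning the first
   variable to n costs about n/2 further variables, so n variables suffice for
   large n. *)
Require Import Defs.
From mathcomp Require Import all_boot all_order all_algebra.
From mathcomp Require Import mpoly zify.

Set Implicit Arguments.
Unset Strict Implicit.
Unset Printing Implicit Defensive.

(** * Recursive enumerability of the pairs below [f] *)

Lemma reval_inj n (c : recfun n) v y1 y2 :
  reval c v y1 -> reval c v y2 -> y1 = y2.
Proof.
elim: c v y1 y2 => {n} [n||n i|k n c IHc d IHd|k c IHc d IHd|k c IHc] v y1 y2 /=;
  try by move=> -> ->.
- move=> [w1 [Hd1 Hc1]] [w2 [Hd2 Hc2]].
  suff E : w1 = w2 by rewrite -E in Hc2; exact: IHc Hc1 Hc2.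
  by apply: eq_from_tnth => i; exact: IHd (Hd1 i) (Hd2 i).
- move=> [h1 [H01 HS1 ->]] [h2 [H02 HS2 ->]].
  suff H i : i <= thead v -> h1 i = h2 i by exact: H.
  elim: i => [_|i IHi lt_iv]; first exact: IHc H01 H02.
  have := HS2 i lt_iv; rewrite -(IHi (ltnW lt_iv)).
  exact: IHd (HS1 i lt_iv).
- move=> [H1 P1] [H2 P2].
  case: (ltngtP y1 y2) => // lt_y.
    by have [u Hu] := P2 _ lt_y; have := IHc _ _ _ H1 Hu.
  by have [u Hu] := P1 _ lt_y; have := IHc _ _ _ H2 Hu.
Qed.

Definition rec_pred : recfun 1 := rprec (rzero 0) (rproj (ord0 : 'I_2)).

(* The subtrahend comes first, as the recursion argument. *)
Definition rec_sub : recfun 2 :=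
  rprec (rproj (ord0 : 'I_1)) (rcomp rec_pred (fun=> rproj (inord 1 : 'I_3))).

Lemma reval_pred a : reval rec_pred [tuple a] a.-1.
Proof. by exists predn; split. Qed.

Lemma reval_sub a b : reval rec_sub [tuple a; b] (b - a).
Proof.
exists (fun i => b - i); split => //= [|i _]; first by rewrite subn0.
exists [tuple b - i]; split; last by rewrite subnS; exact: reval_pred.
by move=> j; rewrite (ord1 j) !(tnth_nth 0) /= inordK.
Qed.

(** Minimisation of t + 1 - f(n), which ignores the search variable, stops at once if t < f(n) and
    never otherwise, since the truncated difference is 0 exactly in the first case. *)
Lemma below_computable_re f : computable f ->
  recursively_enumerable
    (fun v : 2.-tuple nat => tnth v (inord 1) < f (tnth v (inord 0))).
Proof.
move=> [c Hc].
(* The search variable is argument 0, so n and t are read at positions 1 and 2. *)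
pose T : recfun 3 := rcomp (rsucc) (fun=> rproj (inord 2 : 'I_3)).
pose F : recfun 3 := rcomp c (fun=> rproj (inord 1 : 'I_3)).
pose g : recfun 3 := rcomp rec_sub (fun i : 'I_2 => if i == 0 :> nat then F else T).
have Hg (z : nat) (v : 2.-tuple nat) :
    reval g [tuple of z :: v] ((tnth v (inord 1)).+1 - f (tnth v (inord 0))).
  exists [tuple f (tnth v (inord 0)); (tnth v (inord 1)).+1].
  split; last exact: reval_sub.
  case=> [[|[|//]] Hi]; rewrite /=.
    exists [tuple tnth v (inord 0)]; split=> [j|]; last exact: Hc.
    by rewrite (ord1 j) !(tnth_nth 0) /= !inordK.
  exists [tuple tnth v (inord 1)]; split=> [j|//].
  by rewrite (ord1 j) !(tnth_nth 0) /= !inordK.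
exists (rmin g) => v; split.
  move=> lt_f; exists 0; split=> //.
  by move: (Hg 0 v); move: lt_f; rewrite -subn_eq0 => /eqP ->.
move=> [y [H _]].
by have /eqP := reval_inj (Hg y v) H; rewrite subn_eq0.
Qed.

(** * Straight-line programs and their equations *)

(** Each instruction appends one value to a list and refers to earlier values by position; the
    appended value is the variable that the matching equation determines. *)
Inductive instr := IOne | IAdd of nat & nat | IMul of nat & nat.

Definition value (s : seq nat) (c : instr) : nat :=
  match c with
  | IOne => 1
  | IAdd i j => nth 0 s i + nth 0 s j
  | IMul i j => nth 0 s i * nth 0 s j
  end.

Definition step s c := rcons s (value s c).
Definition run := foldl step.

Definition wf_instr k (c : instr) :=
  match c with
  | IOne => true
  | IAdd i j | IMul i j => (i < k) && (j < k)
  end.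

Fixpoint wf k (p : seq instr) :=
  if p is c :: p' then wf_instr k c && wf k.+1 p' else true.

Definition instr_eq N k (c : instr) : equation N.+1 :=
  match c with
  | IOne => EqOne (inord k)
  | IAdd i j => EqAdd (inord i) (inord j) (inord k)
  | IMul i j => EqMul (inord i) (inord j) (inord k)
  end.

Fixpoint prog_eqs N k (p : seq instr) : seq (equation N.+1) :=
  if p is c :: p' then instr_eq N k c :: prog_eqs N k.+1 p' else [::].

Lemma wf_cat k p1 p2 : wf k (p1 ++ p2) = wf k p1 && wf (k + size p1) p2.
Proof.
elim: p1 k => [|c p1 IH] k /=; first by rewrite addn0.
by rewrite IH andbA addSnnS.
Qed.

Lemma run_cat s p1 p2 : run s (p1 ++ p2) = run (run s p1) p2.
Proof. exact: foldl_cat. Qed.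

Lemma size_run s p : size (run s p) = size s + size p.
Proof.
elim: p s => [|c p IH] s /=; first by rewrite addn0.
by rewrite IH size_rcons addSnnS.
Qed.

Lemma nth_run s p i : i < size s -> nth 0 (run s p) i = nth 0 s i.
Proof.
elim: p s => [//|c p IH] s lt_i /=.
by rewrite IH ?nth_rcons ?lt_i // size_rcons ltnW.
Qed.

Lemma take_run s p : take (size s) (run s p) = s.
Proof.
apply: (@eq_from_nth _ 0) => [|i]; rewrite size_take size_run.
  by case: ifP; lia.
move=> lt_i; have lt_is : i < size s by case: ifP lt_i; lia.
by rewrite nth_take // nth_run.
Qed.

Lemma tnth_inord N (x : N.+1.-tuple nat) i : i < N.+1 ->
  tnth x (inord i) = nth 0 x i.
Proof. by move=> lt_i; rewrite (tnth_nth 0) inordK. Qed.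

Lemma satisfies_instr N (x : N.+1.-tuple nat) k c : wf_instr k c -> k < N.+1 ->
  satisfies x (instr_eq N k c) = (value (take k x) c == nth 0 x k).
Proof.
case: c => [|i j|i j] /=; first by move=> _ lt_k; rewrite tnth_inord // eq_sym.
  move=> /andP[lt_i lt_j] lt_k.
  by rewrite !tnth_inord ?nth_take //; exact: ltn_trans lt_k.
move=> /andP[lt_i lt_j] lt_k.
by rewrite !tnth_inord ?nth_take //; exact: ltn_trans lt_k.
Qed.

(** Each equation fixes the variable at its position in terms of earlier ones, so a solution is
    determined by its first [k] entries. *)
Lemma satisfies_prog N (x : N.+1.-tuple nat) k p :
  wf k p -> k + size p = N.+1 ->
  all (satisfies x) (prog_eqs N k p) = (x == run (take k x) p :> seq nat).
Proof.
elim: p k => [|c p IH] k /=.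
  by rewrite addn0 => _ ->; rewrite take_oversize ?size_tuple ?eqxx.
move=> /andP[wf_c wf_p] E; have lt_k : k < N.+1 by lia.
rewrite satisfies_instr // IH //; last by rewrite addSnnS.
rewrite (take_nth 0) ?size_tuple // /step.
(* Later instructions never change position [k], so [x] is not the run if its entry there is
   wrong. *)
have [->//|ne] /= := eqVneq; apply/esym/negbTE.
apply: contra ne => /eqP Ex.
rewrite [X in _ == nth 0 X _]Ex nth_run; last first.
  by rewrite size_rcons size_takel ?size_tuple // ltnW.
by rewrite nth_rcons size_takel ?size_tuple ?ltnn ?eqxx // ltnW.
Qed.

(** * Polynomials evaluated by programs *)

(* Quantifying over the previous instructions makes realizability closed under
   pointwise sums and products. *)
Definition realizable L (F : seq nat -> nat) :=
  forall p0, wf L p0 -> exists p1 r,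
    [/\ wf L (p0 ++ p1), r < L + size (p0 ++ p1)
      & forall s, size s = L -> nth 0 (run s (p0 ++ p1)) r = F s].

Lemma realizable_one L : realizable L (fun=> 1).
Proof.
move=> p0 wf0; exists [:: IOne], (L + size p0); split.
- by rewrite wf_cat wf0.
- by rewrite size_cat /= addn1 addnS.
- move=> s sz; rewrite run_cat /= /step nth_rcons size_run sz ltnn eqxx //.
Qed.

Lemma realizable_nth L i : i < L -> realizable L (fun s => nth 0 s i).
Proof.
move=> lt_i p0 wf0; exists [::], i; rewrite cats0; split=> //.
  exact: ltn_addr.
by move=> s sz; rewrite nth_run ?sz.
Qed.

(** The program for [G] extends the one for [F] and leaves the value at [r1] intact; one more
    instruction combines both results. *)
Lemma realizable_op L F G (I : nat -> nat -> instr) (op : nat -> nat -> nat) :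
  (forall k i j, wf_instr k (I i j) = (i < k) && (j < k)) ->
  (forall s i j, value s (I i j) = op (nth 0 s i) (nth 0 s j)) ->
  realizable L F -> realizable L G -> realizable L (fun s => op (F s) (G s)).
Proof.
move=> wfI valI HF HG p0 /HF[p1 [r1 [wf1 lt1 E1]]].
have [p2 [r2 [wf2 lt2 E2]]] := HG _ wf1.
set p := (_ ++ _) in wf2 lt2 E2.
exists (p1 ++ p2 ++ [:: I r1 r2]), (L + size p).
have -> : p0 ++ p1 ++ p2 ++ [:: I r1 r2] = p ++ [:: I r1 r2].
  by rewrite /p !catA.
split.
- rewrite wf_cat wf2 /= wfI lt2 andbT /p !size_cat in lt1 *.
  by rewrite andbT; lia.
- by rewrite size_cat /= addn1 addnS.
- move=> s sz; rewrite run_cat /= /step nth_rcons size_run sz ltnn eqxx valI.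
  by rewrite E2 // /p run_cat nth_run ?E1 // size_run sz.
Qed.

Lemma realizable_add L F G :
  realizable L F -> realizable L G -> realizable L (fun s => F s + G s).
Proof. exact: (@realizable_op L F G IAdd addn). Qed.

Lemma realizable_mul L F G :
  realizable L F -> realizable L G -> realizable L (fun s => F s * G s).
Proof. exact: (@realizable_op L F G IMul muln). Qed.

Section Polynomials.
Import GRing.Theory.
Local Open Scope ring_scope.
Variable L : nat.

(** Variables range over natural numbers, so negative coefficients are moved to a subtrahend. *)
Definition diff_realizable (W : {mpoly int[L]}) :=
  exists F G, [/\ realizable L F, realizable L G &
    forall s, W.@[fun i => Posz (nth 0%N s i)] = Posz (F s) - Posz (G s)].

Lemma diff_realizable0 : diff_realizable 0.
Proof.
(* There is no instruction for the constant 0, so it is written 1 - 1. *)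
exists (fun=> 1%N), (fun=> 1%N); split; try exact: realizable_one.
by move=> s; rewrite meval0 subrr.
Qed.

Lemma diff_realizable1 : diff_realizable 1.
Proof.
exists (fun=> (1 + 1)%N), (fun=> 1%N); split; try exact: realizable_one.
  exact: realizable_add (@realizable_one L) (@realizable_one L).
by move=> s; rewrite meval1 PoszD addrK.
Qed.

Lemma diff_realizableX i : diff_realizable 'X_i.
Proof.
exists (fun s => nth 0 s i + 1)%N, (fun=> 1%N); split.
- exact: realizable_add (realizable_nth (ltn_ord i)) (@realizable_one L).
- exact: realizable_one.
- by move=> s; rewrite mevalXU PoszD addrK.
Qed.

Lemma diff_realizableD V W :
  diff_realizable V -> diff_realizable W -> diff_realizable (V + W).
Proof.
move=> [F1 [G1 [HF1 HG1 E1]]] [F2 [G2 [HF2 HG2 E2]]].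
exists (fun s => F1 s + F2 s)%N, (fun s => G1 s + G2 s)%N.
split; try exact: realizable_add.
by move=> s; rewrite mevalD E1 E2; lia.
Qed.

Lemma diff_realizableN V : diff_realizable V -> diff_realizable (- V).
Proof.
move=> [F [G [HF HG E]]]; exists G, F; split=> // s.
by rewrite mevalN E opprB.
Qed.

Lemma diff_realizableM V W :
  diff_realizable V -> diff_realizable W -> diff_realizable (V * W).
Proof.
move=> [F1 [G1 [HF1 HG1 E1]]] [F2 [G2 [HF2 HG2 E2]]].
exists (fun s => F1 s * F2 s + G1 s * G2 s)%N, (fun s => F1 s * G2 s + G1 s * F2 s)%N.
split; try by apply: realizable_add; exact: realizable_mul.
by move=> s; rewrite mevalM E1 E2; lia.
Qed.

(** An integer coefficient is repeated addition, followed by negation if it is negative. *)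
Lemma diff_realizableZ (c : int) V : diff_realizable V -> diff_realizable (c *: V).
Proof.
move=> HV; rewrite -[c]intz scaler_int.
have Hn n : diff_realizable (V *+ n).
  elim: n => [|n IH]; first exact: diff_realizable0.
  by rewrite mulrS; exact: diff_realizableD.
case: c => n; first exact: Hn.
by rewrite NegzE mulrNz; apply: diff_realizableN; exact: Hn.
Qed.

Lemma diff_realizable_mpoly W : diff_realizable W.
Proof.
elim/mpolyind: W => [|c m W _ _ HW]; first exact: diff_realizable0.
apply: diff_realizableD HW; apply: diff_realizableZ.
rewrite mpolyXE_id; elim/big_ind: _ => [||i _].
- exact: diff_realizable1.
- exact: diff_realizableM.
- elim: (m i) => [|k IH]; first exact: diff_realizable1.
  by rewrite exprS; apply: diff_realizableM => //; exact: diff_realizableX.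
Qed.

End Polynomials.

(** * The system of equations of a polynomial *)

(* [k] is the position of the first element, which has value 1. *)
Definition chain k r : seq instr :=
  [seq if i is j.+1 then IAdd (k + j) k else IOne | i <- iota 0 r].

Lemma chainS k r :
  chain k r.+1 = rcons (chain k r) (if r is j.+1 then IAdd (k + j) k else IOne).
Proof. by rewrite /chain -addn1 iotaD map_cat cats1. Qed.

Lemma wf_chain k r : wf k (chain k r).
Proof.
elim: r => // r IH; rewrite chainS -cats1 wf_cat IH size_map size_iota.
by case: r {IH} => //= r; rewrite addnS ltnS leqnn ltnS leq_addr.
Qed.

Lemma run_chain s r : run s (chain (size s) r) = s ++ iota 1 r.
Proof.
elim: r => [|r IH]; first by rewrite cats0.
rewrite chainS -cats1 run_cat IH -[in RHS](addn1 r) iotaD catA add1n cats1 /= /step.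
congr rcons; case: r {IH} => [//|r]; rewrite /value.
by rewrite !nth_cat !ltnNge leq_addr leqnn addKn subnn !nth_iota // addn0 addn1.
Qed.


(* The variables are the [L] arguments of [W], then the intermediate values of
   its evaluation, then a chain with values 1, 2, and so on.  The chain fills
   all remaining places, so that it reaches at least half of the number of
   variables, which is hence the sum of two of its members. *)
Lemma poly_system L (W : {mpoly int[L]}) : 0 < L ->
  exists K, forall N, K <= N -> exists q (U : {set equation N.+1}),
    L + size q = N.+1 /\
    forall x : N.+1.-tuple nat, solution U x <->
      exists s : L.-tuple nat, [/\ val x = run s q, nth 0 s 0 = N.+1
        & W.@[fun i => Posz (tnth s i)] = 0%R].
Proof.
move=> L_gt0; have [F [G [HF HG EW]]] := diff_realizable_mpoly W.
(* [F] is computed first and [G] after it, so that one program holds both values. *)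
have [p1 [rF [wf1 ltF EF]]] := HF [::] isT.
have [p2 [rG [wf2 ltG EG]]] := HG _ wf1.
set p := (_ ++ p2) in wf2 ltG EG; pose K := L + size p.
have {}EF s : size s = L -> nth 0 (run s p) rF = F s.
  by move=> sz; rewrite /p run_cat nth_run ?EF // size_run sz.
have {}ltF : rF < K.
  by apply: leq_trans ltF _; rewrite /K /p (size_cat _ p2) leq_add2l leq_addr.
(* The bound gives [K <= a], so the chain length [r] is at least [b], the larger half of [N.+1]. *)
exists K.*2.+2 => N leN.
pose a := N.+1./2; pose b := uphalf N.+1; pose r := N.+1 - K.
pose q := p ++ chain K r.
have size_q : L + size q = N.+1.
  by rewrite /q size_cat size_map size_iota addnA /r -/K; lia.
have wf_q : wf L q by rewrite wf_cat wf2 wf_chain.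
have Eab : a + b = N.+1 by rewrite /a /b; lia.
have [a_gt0 le_ar] : 0 < a /\ a <= r by rewrite /a /r; lia.
have [b_gt0 le_br] : 0 < b /\ b <= r by rewrite /b /r; lia.
have rK : K + r = N.+1 by rewrite /r; lia.
have run_q s : size s = L -> run s q = run s p ++ iota 1 r.
  by move=> sz; rewrite /q run_cat -(run_chain (run s p)) size_run sz.
(* The chain has the value j + 1 at position [K + j], so this equation forces the first variable to
   be a + b. *)
pose e1 : equation N.+1 := EqAdd (inord (K + a.-1)) (inord (K + b.-1)) (inord 0).
(* Position [K] holds the 1 that starts the chain; multiplying by it expresses F = G, that is, W =
   0. *)
pose e2 : equation N.+1 := EqMul (inord rF) (inord K) (inord rG).
have e1P (x : N.+1.-tuple nat) s : size s = L -> x = run s q :> seq nat ->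
    satisfies x e1 = (nth 0 s 0 == N.+1).
  move=> sz Ex; rewrite /= !tnth_inord; try lia.
  rewrite Ex (nth_run q (_ : 0 < size s)) ?sz // run_q // !nth_cat size_run sz -/K !ltnNge !leq_addr /=.
  by rewrite !addKn !nth_iota; try lia.
have e2P (x : N.+1.-tuple nat) (s : L.-tuple nat) : x = run s q :> seq nat ->
    satisfies x e2 = (W.@[fun i => Posz (tnth s i)] == 0%R).
  move=> Ex; have sz : size s = L by rewrite size_tuple.
  have -> : W.@[fun i => Posz (tnth s i)] = (Posz (F s) - Posz (G s))%R.
    by rewrite -EW; apply: mpoly.meval_eq => i; rewrite (tnth_nth 0).
  rewrite /= !tnth_inord; try lia.
  rewrite Ex run_q // !nth_cat size_run sz -/K ltF ltG ltnn subnn EF // EG //.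
  by rewrite nth_iota ?muln1 ?GRing.subr_eq0 //; lia.
exists q, [set e in prog_eqs N L q ++ [:: e1; e2]]; split=> // x.
have -> : solution [set e in prog_eqs N L q ++ [:: e1; e2]] x =
    [&& x == run (take L x) q :> seq nat, satisfies x e1 & satisfies x e2].
  rewrite -satisfies_prog //.
  have -> : solution [set e in prog_eqs N L q ++ [:: e1; e2]] x =
      all (satisfies x) (prog_eqs N L q ++ [:: e1; e2]).
    apply/forall_inP/allP => H e; first by move=> He; apply: H; rewrite inE.
    by rewrite inE; exact: H.
  by rewrite all_cat [all _ [:: _; _]]/= andbT.
split.
  have sz : size (take L x) == L by rewrite size_takel // size_tuple; lia.
  move=> /and3P[/eqP Ex]; rewrite (e1P _ _ (eqP sz) Ex) => /eqP E1.
  by rewrite (e2P _ (Tuple sz) Ex) => /eqP E2; exists (Tuple sz).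
move=> [s [Ex E1 E2]]; have sz : size s = L by rewrite size_tuple.
rewrite (e1P _ _ sz Ex) (e2P _ _ Ex) E1 E2 !eqxx !andbT.
(* A run keeps its input as a prefix, so [s] is recovered from [x]. *)
have Et : take L x = s by have := take_run s q; rewrite sz -Ex.
by rewrite Et -Ex.
Qed.

(** * Counting the solutions *)

Theorem theorem1 (hM : Matiyasevich_conjecture)
    (f : nat -> nat) (hf : computable f) :
  exists m : nat, 0 < m /\
    forall n : nat, m <= n ->
      exists U : {set equation n}, has_exactly (f n) (solution U).
Proof.
have [m [W [Wrep Wsf]]] := hM 2 isT _ (below_computable_re hf).
have [K HK] := poly_system W isT.
exists K.+1; split=> // -[//|N] /HK[q [U [size_q solU]]]; exists U.
have arg (t : nat) : tnth [tuple N.+1; t] (inord 0) = N.+1 /\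
    tnth [tuple N.+1; t] (inord 1) = t.
  by rewrite !(tnth_nth 0) !inordK.
(* For each t < f(n) a witness [u] is chosen; the run from (n, t, u) will be the solution listed for
   t. *)
have /fin_all_exists [X HX] (t : 'I_(f N.+1)) : exists x : N.+1.-tuple nat,
    exists2 u : m.-tuple nat, poly_zero W [tuple N.+1; nat_of_ord t] u
      & x = run ([:: N.+1; nat_of_ord t] ++ u) q :> seq nat.
  have [u Hu] : exists u, poly_zero W [tuple N.+1; nat_of_ord t] u.
    by apply/Wrep; have [-> ->] := arg t.
  have sz : size (run ([:: N.+1; nat_of_ord t] ++ u) q) == N.+1.
    by rewrite size_run size_cat size_tuple size_q.
  by exists (Tuple sz), u.
exists [seq X t | t <- enum 'I_(f N.+1)]; split.
- rewrite map_inj_uniq ?enum_uniq // => t1 t2 E.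
  (* The second variable of [X t] is t, so distinct t give distinct solutions. *)
  have [u1 _ E1] := HX t1; have [u2 _ E2] := HX t2.
  move: E1; rewrite E E2 => /(congr1 (nth 0 ^~ 1)).
  by rewrite !nth_run // => -[/val_inj].
- by rewrite size_map size_enum_ord.
- move=> x; apply/idP/idP => [/mapP[t _ ->]|/solU[s [Ex E1 E2]]].
    apply/solU; have [u Hu E] := HX t.
    by exists [tuple of [tuple N.+1; nat_of_ord t] ++ u].
  (* The first input is forced to be n; the second is named t and the rest is a witness for it. *)
  have [t [u Es]] : exists (t : nat) (u : m.-tuple nat),
      s = [tuple of [tuple N.+1; t] ++ u].
    case/tupleP: s E1 {Ex E2} => i s /= ->; case/tupleP: s => t u.
    by exists t, u; apply: val_inj.
  rewrite Es in Ex E2; have /= := iffRL (Wrep [tuple N.+1; t]) (ex_intro _ u E2).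
  have [-> ->] := arg t => lt_t; apply/mapP; exists (Ordinal lt_t); first by rewrite mem_enum.
  have [v Hv E] := HX (Ordinal lt_t).
  (* Single-foldness identifies the witness inside [x] with the one chosen for t. *)
  by apply: val_inj; rewrite /= E Ex (Wsf _ _ _ Hv E2).
Qed.
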